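(* Let $n \geq 1$, let $m = n!$, and let $A_1, \ldots, A_n$ be arbitrary complex numbers. Then the system of equations $$\frac{1}{m} \left(z_1^j + \cdots + z_m^j\right) = A_j^j, \qquad 1 \leq j \leq n,$$ in the $m$ complex variables $z_1, \ldots, z_m$ has a solution $(z_k)_{1 \leq k \leq n!}$ such that $$\max_{1 \leq k \leq n!} |z_k| \leq D_n \max_{1 \leq j \leq n} |A_j|.$$
   Context: The sequence $(D_n)_{n \geq 1}$ of real numbers is defined inductively by $D_1 = 1$ and $$D_{n+1} = 1 + \left( 1 + D_n^{n+1} \right)^{1/(n+1)}, \qquad n \geq 1.$$ *)

(* Defs.v *)
From mathcomp Require Import all_boot all_order all_algebra.
From mathcomp Require Import reals exp.
Set Implicit Arguments.
Unset Strict Implicit.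
Unset Printing Implicit Defensive.
Import GRing.Theory.
Local Open Scope ring_scope.

(* The sequence starts at index 1; the value at 0 is a dummy that is never used
   by the recursion. *)
Fixpoint Dseq (R : realType) (n : nat) : R :=
  match n with
  | 0 => 0
  | 1 => 1
  | k.+1 => 1 + (1 + Dseq R k ^+ k.+1) `^ (k.+1%:R^-1)
  end.

Lemma Dseq1 (R : realType) : Dseq R 1 = 1.
Proof. by []. Qed.

Lemma DseqS (R : realType) (n : nat) : (1 <= n)%N ->
  Dseq R n.+1 = 1 + (1 + Dseq R n ^+ n.+1) `^ (n.+1%:R^-1).
Proof. by case: n. Qed.

(* Main.v *)
(** It suffices to find [n] points with the prescribed power means and to repeat
    each of them [(n-1)!] times.  Write the points as [A_1 + v], so that the [v]
    must have prescribed power means [mu_j]; if [|A_j| <= b] for all [j], then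
    [|mu_j| <= (2^j - 2) b^j], the terms of degree 0 and 1 of the binomial
    expansion nearly cancelling.  The [v] are the roots of the monic polynomial
    with coefficients [c_k] given by Newton's identities
    [k c_k = - \sum_(l < k) c_l n mu_(k-l)], and Cauchy's root bound gives
    [|v| <= (D_n - 1) b] once [\sum_(1 <= k <= n) |c_k| / ((D_n - 1) b)^k <= 1].
    This follows from the majorised recursion and [D_n >= n + 2/5] for [n >= 2],
    obtained from [D_(n+1) >= 1 + D_n] and [D_2 = 1 + sqrt 2]. *)
Require Import Defs.
From mathcomp Require Import all_boot all_order all_algebra.
From mathcomp Require Import reals exp.
From mathcomp Require Import complex.
From mathcomp Require Import ring lra zify.
Set Implicit Arguments.
Unset Strict Implicit.
Unset Printing Implicit Defensive.
Import Order.TTheory GRing.Theory Num.Theory.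
Local Open Scope ring_scope.

(** * Lower bounds for the sequence [Dseq] *)

Lemma Dseq_ge0 (R : realType) (n : nat) : 0 <= Dseq R n.
Proof. by case: n => [|[|n]] //=; rewrite addr_ge0 ?powR_ge0. Qed.

Lemma Dseq2_sqr (R : realType) : (Dseq R 2 - 1) ^+ 2 = 2.
Proof.
rewrite DseqS // expr1n addrAC subrr add0r -powR_mulrn ?powR_ge0 // -powRrM.
by rewrite mulVf ?pnatr_eq0 // powRr1 // addr_ge0.
Qed.

Lemma Dseq_ge (R : realType) (n : nat) : (2 <= n)%N -> n%:R + 2 / 5 <= Dseq R n.
Proof.
(* Dropping the summand 1 under the root leaves the root of [Dseq R m ^+ m.+1], which is
   [Dseq R m]. *)
have DS m : (1 <= m)%N -> 1 + Dseq R m <= Dseq R m.+1.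
  move=> m1; rewrite DseqS // lerD2l.
  have {1}-> : Dseq R m = (Dseq R m ^+ m.+1) `^ m.+1%:R^-1.
    rewrite -powR_mulrn ?Dseq_ge0 // -powRrM mulfV ?pnatr_eq0 //.
    by rewrite powRr1 ?Dseq_ge0.
  by rewrite ge0_ler_powR ?nnegrE ?invr_ge0 ?addr_ge0 ?exprn_ge0 ?Dseq_ge0 ?lerDr.
elim: n => [//|[//|[|n]] IH] _.
  have := Dseq2_sqr R; set x := Dseq R 2 => x2.
  have x1 : 0 <= x - 1 by rewrite /x DseqS // addrAC subrr add0r powR_ge0.
  (* [x < 12 / 5] contradicts [(x - 1) ^+ 2 = 2], because [(7 / 5) ^+ 2 = 49 / 25 < 2]. *)
  rewrite leNgt; apply/negP => xlt.
  have : (7 / 5 - (x - 1)) * (7 / 5 + (x - 1)) <= 0 by rewrite -subr_sqr x2; lra.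
  by rewrite pmulr_lle0; lra.
apply: le_trans (DS n.+2 isT); rewrite -natr1; have := IH isT; lra.
Qed.

(** * Estimates for the majorised Newton recursion *)

Section Majorant.
Variable R : realFieldType.
Implicit Types (r : R) (s : nat -> R).

(** The full series is [2 / (r - 2) - 2 / (r - 1)], which is the right-hand side; the exact
    remainder after [m] terms is nonnegative. *)
Lemma sum_weights_le r m : 2 < r ->
  \sum_(1 <= i < m.+1) (2 ^+ i - 2) / r ^+ i <= 2 / ((r - 1) * (r - 2)).
Proof.
move=> r2.
have r0 : r != 0 by lra.
have tail : \sum_(1 <= i < m.+1) (2 ^+ i - 2) / r ^+ i =
    2 / ((r - 1) * (r - 2)) - (2 ^+ m.+1 / (r - 2) - 2 / (r - 1)) / r ^+ m.
  elim: m => [|m IH]; first by rewrite big_geq // expr0 expr1; field; lra.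
  rewrite big_nat_recr //= IH !exprS; field.
  by rewrite expf_neq0 // r0 /=; lra.
rewrite tail gerBl divr_ge0 ?exprn_ge0 ?subr_ge0 //; last lra.
have e1 : 1 <= 2 ^+ m :> R by rewrite exprn_ege1 // ler1n.
rewrite exprS ler_pdivrMr; last lra.
rewrite mulrAC ler_pdivlMr; last lra.
by nra.
Qed.

(** Exchange the summations and put [i = k - l]: each [s l] then multiplies a partial sum of the
    weights. *)
Lemma sum_triangle (w s : nat -> R) n (G : R) :
  (forall k, 0 <= s k) ->
  (forall m, (m <= n)%N -> \sum_(1 <= i < m.+1) w i <= G) ->
  \sum_(k < n.+1) \sum_(l < k) s l * w (k - l)%N <= G * \sum_(l < n.+1) s l.
Proof.
move=> s0 wG.
have -> : \sum_(k < n.+1) \sum_(l < k) s l * w (k - l)%N =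
    \sum_(l < n.+1) s l * \sum_(1 <= i < (n - l).+1) w i.
  have E (k : 'I_n.+1) : \sum_(l < k) s l * w (k - l)%N =
      \sum_(l < n.+1 | (l < k)%N) s l * w (k - l)%N.
    by rewrite (big_ord_widen n.+1 (fun l => s l * w (k - l)%N)) // ltnW.
  under eq_bigr => k _ do rewrite E.
  rewrite (exchange_big_dep xpredT) //=; apply: eq_bigr => l _.
  rewrite mulr_sumr -(big_mkord (fun k => (l < k)%N) (fun k => s l * w (k - l)%N)).
  have ln : (l < n.+1)%N by [].
  rewrite (big_cat_nat (n := l.+1)) //= big_nat_cond big_pred0 ?add0r; last first.
    by move=> k; lia.
  have := big_addn 1 n.+1 l (fun k => (l < k)%N) (fun k => s l * w (k - l)%N).
  rewrite add1n => ->.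
  rewrite subSn; last by rewrite -ltnS.
  by apply: congr_big_nat => // k; rewrite ?addnK // => /andP[]; lia.
rewrite mulrC mulr_suml; apply: ler_sum => l _; rewrite ler_wpM2l // wG //.
by rewrite leq_subr.
Qed.

(** Meant for [r = D_n - 1] and [s k = |c_k| / (r b)^k]. The cases [n = 2, 3, 4] are computed term
    by term; from [n = 5] on the recursion is summed over [k], which bounds the sum in terms of
    itself. *)
Lemma majorant_sum_le1 n r s : (2 <= n)%N -> 0 < r -> 2 <= r ^+ 2 ->
  ((3 <= n)%N -> n%:R - 3 / 5 <= r) ->
  s 0%N = 1 -> (forall k, 0 <= s k) ->
  (forall k, (0 < k <= n)%N -> k%:R * s k <=
     n%:R * \sum_(l < k) s l * ((2 ^+ (k - l)%N - 2) / r ^+ (k - l)%N)) ->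
  \sum_(1 <= k < n.+1) s k <= 1.
Proof.
move=> n2 r0 r2 rn s0 s_ge0 rec.
have n0 : 0 < n%:R :> R by rewrite ltr0n; lia.
have s1 : s 1%N = 0.
  apply/eqP; rewrite eq_le s_ge0 andbT.
  have := rec 1%N; rewrite big_ord1 subn0 mul1r expr1 subrr mul0r !mulr0; apply; lia.
set t := r^-1; have t0 : 0 < t by rewrite invr_gt0.
(* This is the last term, [l = k - 1], of each recursion. *)
have w1 l : s l * ((2 ^+ 1 - 2) / r ^+ 1) = 0 by rewrite expr1 subrr mul0r mulr0.
have s2 : s 2%N <= n%:R * t ^+ 2.
  have := rec 2%N; rewrite !big_ord_recl big_ord0 /= s0 s1 -exprVn -/t => /(_ n2).
  lra.
have SE : \sum_(1 <= k < n.+1) s k = \sum_(k < n) s k.+1.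
  by rewrite big_add1 big_mkord.
case: (ltnP n 3) => n3.
  have n_eq2 : n = 2%N by lia.
  move: SE; rewrite n_eq2 in s2 * => SE.
  rewrite SE !big_ord_recl big_ord0 /bump /= s1.
  rewrite add0r addr0; apply: le_trans s2 _.
  rewrite /t exprVn ler_pdivrMr ?exprn_gt0 //; lra.
have {}rn := rn n3.
have s3 : s 3%N <= 2 * n%:R * t ^+ 3.
  have := rec 3%N; rewrite !big_ord_recl big_ord0 /= s0 s1 /bump /= w1.
  by rewrite -!exprVn -/t => /(_ n3); lra.
have t_le b : 0 < b -> b <= r -> t <= b^-1 by move=> b0 br; rewrite lef_pV2.
have X k b : 0 < b -> b <= r -> t ^+ k <= b^-1 ^+ k.
  by move=> b0 br; rewrite lerXn2r ?nnegrE ?invr_ge0 ?t_le // ltW.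
case: (ltnP n 4) => n4.
  have n_eq3 : n = 3%N by lia.
  move: SE; rewrite n_eq3 in rn s2 s3 * => SE.
  rewrite SE !big_ord_recl big_ord0 /bump /= s1.
  have := X 2%N (12 / 5); have := X 3%N (12 / 5); lra.
have s4 : 4 * s 4%N <= n%:R * (14 * t ^+ 4 + 2 * s 2%N * t ^+ 2).
  have := rec 4%N; rewrite !big_ord_recl big_ord0 /= s0 s1 /bump /= w1.
  by rewrite -!exprVn -/t => /(_ n4); lra.
case: (ltnP n 5) => n5.
  have n_eq4 : n = 4%N by lia.
  move: SE; rewrite n_eq4 in rn s2 s3 s4 * => SE.
  rewrite SE !big_ord_recl big_ord0 /bump /= s1.
  have := X 2%N (17 / 5); have := X 3%N (17 / 5); have := X 4%N (17 / 5).
  have : s 2%N * t ^+ 2 <= 4 * t ^+ 4.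
    by rewrite [t ^+ 4](exprD t 2 2) mulrA ler_wpM2r // exprn_ge0 // ltW.
  lra.
have n5R : 5 <= n%:R :> R by rewrite ler_nat.
set S := \sum_(1 <= k < n.+1) s k.
have S0E : \sum_(l < n.+1) s l = 1 + S.
  by rewrite -(big_mkord xpredT) big_nat_recl // s0 /S big_add1.
have S_ge0 : 0 <= S by exact: sumr_ge0.
pose G := 2 / ((r - 1) * (r - 2)).
have sumrec : \sum_(1 <= k < n.+1) k%:R * s k <= n%:R * (G * (1 + S)).
  rewrite -S0E; apply: le_trans (_ : n%:R * \sum_(k < n.+1) \sum_(l < k)
      s l * ((2 ^+ (k - l)%N - 2) / r ^+ (k - l)%N) <= _).
    rewrite mulr_sumr big_ord_recl big_ord0 mulr0 add0r.
    rewrite big_add1 big_mkord; apply: ler_sum => k _.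
    by apply: rec; have := ltn_ord k; lia.
  rewrite ler_wpM2l //; apply: (@sum_triangle (fun i => (2 ^+ i - 2) / r ^+ i)) => //.
  by move=> m _; apply: sum_weights_le; lra.
(* As [s 1 = 0], weighting by [k] gains a factor 3 on all terms but [s 2], which
   is enough to close the recursion. *)
have sum3 : 3 * S - s 2%N <= \sum_(1 <= k < n.+1) k%:R * s k.
  rewrite /S SE [leRHS]big_add1 big_mkord /=.
  have -> : n = n.-2.+2 by lia.
  rewrite !big_ord_recl /= s1 !mulrDr !mulr0 !add0r /bump /=.
  suff : 3 * \sum_(i < n.-2) s i.+3 <= \sum_(i < n.-2) i.+3%:R * s i.+3 by lra.
  by rewrite mulr_sumr ler_sum // => i _; rewrite ler_wpM2r // ler_nat.
(* The constants here and in [nt] fit the worst case [n = 5], [r = 22 / 5], where the left-hand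
   sides are about 1.226 and 0.258. *)
have nG : n%:R * G <= 5 / 4.
  rewrite /G mulrA ler_pdivrMr; last by nra.
  nra.
have nt : n%:R * t ^+ 2 <= 27 / 100.
  by rewrite /t exprVn ler_pdivrMr ?exprn_gt0 //; nra.
(* Together, [3 S - 27 / 100 <= 5 / 4 (1 + S)], hence [S <= 152 / 175]. *)
nra.
Qed.
End Majorant.

(** * Newton's identities and points with prescribed power sums *)

Section Newton.
Variable F : comNzRingType.
Implicit Types (s : seq F) (v x : F).

(* Elementary symmetric functions, with the sign [(-1)^k] included. *)
Fixpoint esf s k : F :=
  if s is v :: s' then esf s' k - (if k is k'.+1 then v * esf s' k' else 0)
  else (k == 0)%:R.

Lemma esf0 s : esf s 0 = 1.
Proof. by elim: s => //= v s ->; rewrite subr0. Qed.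

Lemma esf_gt s k : (size s < k)%N -> esf s k = 0.
Proof.
elim: s k => [|v s IH] [|k] //= ltk; rewrite !IH ?mulr0 ?subr0 //.
exact: ltnW.
Qed.

Lemma coef_prod_XsubC s k : (k <= size s)%N ->
  (\prod_(v <- s) ('X - v%:P))`_(size s - k) = esf s k.
Proof.
elim: s k => [|v s IH] k /=.
  by rewrite leqn0 => /eqP ->; rewrite big_nil coef1.
move=> kS; rewrite big_cons mulrBl coefB coefXM coefCM; congr (_ - _).
  case: (ltngtP k (size s).+1) kS => // [kS|->] _.
    by rewrite subSn //= IH.
  by rewrite subnn esf_gt.
case: k kS => [_|k kS]; last by rewrite subSS IH.
by rewrite subn0 nth_default ?mulr0 // size_prod_XsubC.
Qed.

(** In generating functions, [esf (v :: s)] is [esf s] times [1 - v X], and the sum multiplies by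
    the geometric series inverse to that factor. *)
Lemma sum_esf_geom v s k :
  \sum_(l < k.+1) esf (v :: s) l * v ^+ (k - l) = esf s k.
Proof.
elim: k => [|k IH]; first by rewrite big_ord1 subnn mulr1 /= subr0.
rewrite big_ord_recr /= subnn mulr1 -IH mulr_sumr.
under eq_bigr => l _ do rewrite subSn ?leq_ord // exprS mulrCA.
by rewrite /=; ring.
Qed.

(** Induction on the list: [sum_esf_geom] handles the powers of the new entry, and the recursion of
    [esf] reduces the rest to the identities for the tail at [k] and [k - 1]. *)
Lemma newton_identity s k :
  k%:R * esf s k + \sum_(l < k) esf s l * \sum_(v <- s) v ^+ (k - l) = 0.
Proof.
elim: s k => [|v s IH] k.
  rewrite big1 => [|l _]; last by rewrite big_nil mulr0.
  by case: k => [|k] /=; rewrite ?mulr0 ?mul0r addr0.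
have IH' j : \sum_(l < j) esf s l * \sum_(u <- s) u ^+ (j - l) = - (j%:R * esf s j).
  by apply/eqP; rewrite -addr_eq0 addrC IH.
case: k => [|k]; first by rewrite mul0r big_ord0 addr0.
under eq_bigr => l _ do rewrite big_cons mulrDr.
rewrite big_split /=.
have -> : \sum_(l < k.+1) esf (v :: s) l * v ^+ (k.+1 - l) = v * esf s k.
  rewrite -(sum_esf_geom v) mulr_sumr; apply: eq_bigr => l _.
  by rewrite subSn ?leq_ord // exprS mulrCA.
have -> : \sum_(l < k.+1) esf (v :: s) l * \sum_(u <- s) u ^+ (k.+1 - l) =
    \sum_(l < k.+1) esf s l * \sum_(u <- s) u ^+ (k.+1 - l)
    - v * \sum_(l < k) esf s l * \sum_(u <- s) u ^+ (k - l).
  rewrite /=; under eq_bigr => l _ do rewrite mulrBl.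
  rewrite sumrB; congr (_ - _); rewrite big_ord_recl /= mul0r add0r mulr_sumr.
  by apply: eq_bigr => l _; rewrite /bump /= subSS mulrA.
rewrite !IH' /= -natr1; ring.
Qed.

End Newton.

(** Each value depends on all earlier ones, so the sequence is built by overriding one new index at
    a time. *)
Lemma newton_coefs (F : numFieldType) (p : nat -> F) n : exists c : nat -> F,
  c 0%N = 1 /\
  forall k, (0 < k <= n)%N -> k%:R * c k = - \sum_(l < k) c l * p (k - l)%N.
Proof.
elim: n => [|n [c [c0 rec]]]; first by exists (fun=> 1); split=> // [[]].
pose d k := if k == n.+1 then - n.+1%:R^-1 * \sum_(l < n.+1) c l * p (n.+1 - l)%N
            else c k.
have dE k : (k <= n)%N -> d k = c k by rewrite /d; case: eqP => // ->; rewrite ltnn.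
exists d; split=> [|k /andP[k0]]; first by rewrite dE.
rewrite leq_eqVlt => kn.
have -> : \sum_(l < k) d l * p (k - l)%N = \sum_(l < k) c l * p (k - l)%N.
  apply: eq_bigr => l _; rewrite dE // -ltnS (leq_trans (ltn_ord l)) //.
  by case/orP: kn => [/eqP->|/ltnW].
case/orP: kn => [/eqP->|kn]; last by rewrite dE // rec // k0.
by rewrite /d eqxx mulrA mulrN mulfV ?pnatr_eq0 // mulN1r.
Qed.

(** The [c k] are the coefficients, from the top, of a monic polynomial with roots [s]; Newton's
    identities are triangular, so they determine the power sums. *)
Lemma roots_of_power_sums (F : numClosedFieldType) (p c : nat -> F) n :
  c 0%N = 1 ->
  (forall k, (0 < k <= n)%N -> k%:R * c k = - \sum_(l < k) c l * p (k - l)%N) ->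
  exists s : seq F, [/\ size s = n,
    forall j, (0 < j <= n)%N -> \sum_(v <- s) v ^+ j = p j &
    forall v, v \in s -> \sum_(k < n.+1) c k * v ^+ (n - k) = 0].
Proof.
move=> c0 rec; pose P := \poly_(i < n.+1) c (n - i)%N.
have lcP : lead_coef P = 1 by rewrite lead_coef_poly ?subnn ?c0 ?oner_neq0.
have szP : size P = n.+1 by rewrite size_poly_eq // subnn c0 oner_neq0.
have [s Ps] := closed_field_poly_normal P; rewrite lcP scale1r in Ps.
have szs : size s = n by apply: succn_inj; rewrite -szP Ps size_prod_XsubC.
have cE k : (k <= n)%N -> esf s k = c k.
  move=> kn; rewrite -coef_prod_XsubC ?szs // -Ps coef_poly ltnS leq_subr.
  by rewrite subKn.
exists s; split=> // [j|v vs].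
  (* Only the term [l = 0] contains the [j]-th power sum, with coefficient 1; the other terms agree
     by induction. *)
  elim/ltn_ind: j => j IH /andP[j0 jn].
  have := newton_identity s j; have := rec j; rewrite j0 jn cE // => /(_ isT) ->.
  case: j IH j0 jn => // j IH _ jn; rewrite !big_ord_recl /= c0 esf0 !mul1r subn0.
  under [X in _ + (_ + X)]eq_bigr => l _.
    rewrite /bump /= cE ?IH; [over|..]; have := ltn_ord l; lia.
  by move/eqP; rewrite addrC opprD addrACA subrr addr0 subr_eq0 => /eqP.
have : root P v by rewrite Ps root_prod_XsubC.
rewrite /root horner_poly => /eqP Pv; rewrite -[RHS]Pv (reindex_inj rev_ord_inj) /=.
by apply: eq_bigr => k _; rewrite subSS subKn // -ltnS.
Qed.

(** * Undoing a translation at the level of moments *)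

Lemma binomial_inversion (F : comNzRingType) (M : nat -> F) (a : F) k :
  \sum_(j < k.+1) a ^+ (k - j) *
    (\sum_(i < j.+1) (- a) ^+ (j - i) * M i *+ 'C(j, i)) *+ 'C(k, j) = M k.
Proof.
(* [L] is the linear functional [X^i |-> M i] in degrees at most [k]; the inner
   sum is [L ((X - a)^j)], and [X^k] is expanded in powers of [X - a]. *)
pose L (p : {poly F}) := \sum_(i < k.+1) p`_i * M i.
have Lsum m (c : nat -> F) (q : nat -> {poly F}) :
    L (\sum_(i < m) c i *: q i) = \sum_(i < m) c i * L (q i).
  rewrite /L; under eq_bigr => i _ do rewrite coef_sum mulr_suml.
  rewrite exchange_big; apply: eq_bigr => i _; rewrite mulr_sumr.
  by apply: eq_bigr => l _; rewrite coefZ mulrA.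
have LXn i : (i <= k)%N -> L 'X^i = M i.
  move=> ik; rewrite /L (bigD1 (inord i)) //= inordK // coefXn eqxx mul1r.
  rewrite big1 ?addr0 // => j ji; rewrite coefXn.
  case: eqP => [E|]; last by rewrite mul0r.
  by rewrite -E inord_val eqxx in ji.
have binE (x : F) (q : {poly F}) m :
    (x%:P + q) ^+ m = \sum_(i < m.+1) (x ^+ (m - i) *+ 'C(m, i)) *: q ^+ i.
  rewrite exprDn; apply: eq_bigr => i _.
  by rewrite -polyC_exp mul_polyC scalerMnl.
have XkE : 'X^k = (a%:P + ((- a)%:P + 'X)) ^+ k.
  by rewrite polyCN addrA subrr add0r.
rewrite -[RHS]LXn // XkE binE; symmetry.
apply: etrans (Lsum k.+1 (fun j => a ^+ (k - j) *+ 'C(k, j))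
  (fun j => ((- a)%:P + 'X) ^+ j)) _.
apply: eq_bigr => j _; rewrite binE mulrnAl; congr (_ * _ *+ _).
apply: etrans (Lsum j.+1 (fun i => (- a) ^+ (j - i) *+ 'C(j, i)) (fun i => 'X^i)) _.
apply: eq_bigr => i _; rewrite mulrnAl LXn //.
by rewrite (leq_trans (leq_ord i)) // leq_ord.
Qed.

(** * Complex moduli, Cauchy's root bound and centred moments *)

Section ComplexModulus.
Variable R : rcfType.
Implicit Types x : R[i].
Local Notation normc := (@Normc.normc R).

(** The norm of [R[i]] takes values in [R[i]]; this identity carries its properties over to the
    real-valued [normc]. *)
Lemma norm_normc x : `|x| = (normc x)%:C%C.
Proof. by rewrite normc_def; case: x. Qed.

Lemma normc_ge0 x : 0 <= normc x.
Proof. by case: x => a b; exact: sqrtr_ge0. Qed.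

Lemma normcX x n : normc (x ^+ n) = normc x ^+ n.
Proof.
by elim: n => [|n IH]; rewrite ?Normc.normc1 // !exprS Normc.normcM IH.
Qed.

Lemma normc_natr n : normc n%:R = n%:R.
Proof. by apply: (@complexI R); rewrite -norm_normc normr_nat rmorph_nat. Qed.

Lemma normc_opp x : normc (- x) = normc x.
Proof. by apply: (@complexI R); rewrite -!norm_normc normrN. Qed.

Lemma normc_le_add x y : normc (x + y) <= normc x + normc y.
Proof. exact: le_normcD. Qed.

Lemma normc_sum I (r : seq I) (P : pred I) (f : I -> R[i]) :
  normc (\sum_(i <- r | P i) f i) <= \sum_(i <- r | P i) normc (f i).
Proof.
rewrite -lecR -norm_normc rmorph_sum; apply: le_trans (ler_norm_sum _ _ _) _.
by apply: ler_sum => i _; rewrite norm_normc.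
Qed.

(** The weighted sum may equal 1, so for [normc v = x > rho] the contradiction comes from a factor
    [rho / x < 1] pulled out of every term. *)
Lemma cauchy_root_bound n (c : nat -> R[i]) (v : R[i]) (rho : R) : 0 < rho ->
  c 0%N = 1 -> \sum_(k < n.+1) c k * v ^+ (n - k) = 0 ->
  \sum_(1 <= k < n.+1) normc (c k) / rho ^+ k <= 1 -> normc v <= rho.
Proof.
move=> rho0 c0 root_v sum_le1; rewrite leNgt; apply/negP => rho_lt.
set x := normc v in rho_lt; have x0 : 0 < x by exact: lt_trans rho_lt.
have : x ^+ n <= x ^+ n * (rho / x * \sum_(1 <= k < n.+1) normc (c k) / rho ^+ k).
  move: root_v; rewrite big_ord_recl c0 mul1r subn0 => /eqP; rewrite addr_eq0 => /eqP vn.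
  rewrite -[leLHS]normcX {1}vn normc_opp; apply: le_trans (normc_sum _ _ _) _.
  rewrite big_add1 big_mkord /= !mulr_sumr; apply: ler_sum => k _.
  rewrite Normc.normcM normcX -/x /bump /= add1n.
  have -> : x ^+ n = x ^+ (n - k.+1) * x ^+ k.+1 by rewrite -exprD subnK.
  rewrite mulrC -mulrA ler_wpM2l ?exprn_ge0 ?(ltW x0) //.
  have -> : x ^+ k.+1 * (rho / x * (normc (c k.+1) / rho ^+ k.+1)) =
      normc (c k.+1) * (x / rho) ^+ k.
    by rewrite expr_div_n !exprS; field; rewrite ?expf_neq0 ?gt_eqF.
  by rewrite ler_peMr ?normc_ge0 // exprn_ege1 // ler_pdivlMr // mul1r ltW.
rewrite leNgt => /negP; apply.
rewrite gtr_pMr ?exprn_gt0 //; apply: le_lt_trans (_ : rho / x < 1).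
  by rewrite ler_piMr // ltW // divr_gt0.
by rewrite ltr_pdivrMr // mul1r.
Qed.

(** The terms [i = 0, 1] add up to [- (j - 1) (- A_1)^j] and the other binomials to [2^j - 1 - j],
    whence [2^j - 2]. The value [A 0] enters only through [A 0 ^+ 0 = 1]. *)
Lemma centred_moment_bound n (A : nat -> R[i]) (b : R) j :
  (forall i, (1 <= i <= n)%N -> normc (A i) <= b) -> (1 <= j <= n)%N ->
  normc (\sum_(i < j.+1) (- A 1%N) ^+ (j - i) * A i ^+ i *+ 'C(j, i))
    <= (2 ^+ j - 2) * b ^+ j.
Proof.
move=> Ab /andP[]; case: j => // j _ jn.
have b0 : 0 <= b by apply: le_trans (normc_ge0 _) (Ab 1%N _); lia.
have A1X m : normc ((- A 1%N) ^+ m) <= b ^+ m.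
  rewrite normcX normc_opp lerXn2r ?nnegrE ?normc_ge0 ?Ab //; lia.
have binS : \sum_(i < j) 'C(j.+1, i.+2)%:R = 2 ^+ j.+1 - j.+2%:R :> R.
  have : \sum_(i < j.+2) 'C(j.+1, i)%:R = 2 ^+ j.+1 :> R.
    rewrite -[2]/(1 + 1) exprDn; apply: eq_bigr => i _.
    by rewrite !expr1n mulr1.
  rewrite !big_ord_recl /= bin0 bin1 /bump /= => <-.
  by rewrite -[j.+2%:R]natr1; ring.
(* The terms [i = 0] and [i = 1] nearly cancel. *)
rewrite !big_ord_recl /= bin0 bin1 /bump /= !add1n expr0 mulr1 mulr1n addrA.
have -> : (- A 1%N) ^+ (j.+1 - 0) + (- A 1%N) ^+ (j.+1 - 1) * A 1%N ^+ 1 *+ j.+1 =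
    - (j%:R * (- A 1%N) ^+ j.+1).
  by rewrite subn0 subn1 /= exprS -mulr_natl -natr1; ring.
apply: le_trans (normc_le_add _ _) _.
have -> : (2 ^+ j.+1 - 2) * b ^+ j.+1 =
    j%:R * b ^+ j.+1 + b ^+ j.+1 * \sum_(i < j) 'C(j.+1, i.+2)%:R.
  by rewrite binS -2!natr1; ring.
apply: lerD; first by rewrite normc_opp Normc.normcM normc_natr ler_wpM2l.
apply: le_trans (normc_sum _ _ _) _; rewrite mulr_sumr; apply: ler_sum => i _.
rewrite -mulr_natr 2!Normc.normcM normc_natr ler_wpM2r //.
have ij : (i < j)%N by [].
have -> : b ^+ j.+1 = b ^+ (j.+1 - (1 + (1 + i))) * b ^+ (1 + (1 + i)).
  by rewrite -exprD; congr (_ ^+ _); lia.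
rewrite ler_pM ?normc_ge0 // normcX lerXn2r ?nnegrE ?normc_ge0 ?Ab //; lia.
Qed.

End ComplexModulus.

(** * Repetition of points and the final construction *)

Lemma sum_copies (V : nmodType) (F : Type) (x0 : F) (s : seq F) (f : F -> V) q :
  \sum_(k < q * size s) f (nth x0 s (k %% size s)) = (\sum_(v <- s) f v) *+ q.
Proof.
elim: q => [|q IH]; first by rewrite big_ord0.
rewrite mulSn big_split_ord mulrS; congr (_ + _).
  by rewrite (big_nth x0) big_mkord; apply: eq_bigr => i _; rewrite /= modn_small.
by rewrite -IH; apply: eq_bigr => i _; rewrite modnDl.
Qed.

Theorem theorem4 (R : realType) (n : nat) (hn : (1 <= n)%N) (A : nat -> R[i]) :
  exists z : 'I_(n`!) -> R[i],
    (forall j : nat, (1 <= j <= n)%N ->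
       (n`!)%:R^-1 * \sum_(k < n`!) z k ^+ j = A j ^+ j) /\
    \big[Num.max/0]_(k < n`!) Normc.normc (z k)
      <= Dseq R n * \big[Num.max/0]_(1 <= j < n.+1) Normc.normc (A j).
Proof.
set b := \big[Num.max/0]_(1 <= j < n.+1) Normc.normc (A j).
have b0 : 0 <= b by exact: bigmax_ge_id.
have Ab j : (1 <= j <= n)%N -> Normc.normc (A j) <= b.
  move=> jn.
  apply: (@le_bigmax_seq _ _ _ _ 0 j xpredT (fun i => Normc.normc (A i))) => //.
  by rewrite mem_index_iota ltnS.
have factE : n`! = (n.-1`! * n)%N.
  by rewrite -[in LHS](prednK hn) factS prednK // mulnC.
have fact0 : (n`!)%:R != 0 :> R[i] by rewrite pnatr_eq0 -lt0n fact_gt0.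
(* In these cases the constant family [A 1] works; otherwise [2 <= n] and the radius in the root
   bound is positive. *)
have [triv|] := boolP ((n == 1%N) || (b == 0)).
  exists (fun=> A 1%N); split.
    move=> j jn; rewrite sumr_const card_ord -(mulr_natl (A 1%N ^+ j)) mulKf //.
    case/orP: triv => [/eqP n1|/eqP b_eq0].
      by have -> : j = 1%N by lia.
    have A0 i : (1 <= i <= n)%N -> A i = 0.
      move=> /Ab; rewrite b_eq0 => Ai; apply/Normc.eq0_normc/eqP.
      by rewrite eq_le Ai normc_ge0.
    by rewrite !A0 // hn.
  apply: bigmax_le => [|k _]; first by rewrite mulr_ge0 ?Dseq_ge0.
  apply: le_trans (Ab 1%N _) _; first by rewrite hn.
  by case/orP: triv => /eqP ->; rewrite ?mulr0 //= mul1r.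
rewrite negb_or => /andP[n1 b_neq0].
have n2 : (2 <= n)%N by lia.
have b_gt0 : 0 < b by rewrite lt0r b_neq0.
pose r := Dseq R n - 1.
have rn : n%:R - 3 / 5 <= r by rewrite /r; have := Dseq_ge R n2; lra.
have n2R : 2 <= n%:R :> R by rewrite ler_nat.
have r0 : 0 < r by lra.
have r2 : 2 <= r ^+ 2.
  case: (ltnP n 3) => [n3|]; last by rewrite -(ler_nat R); nra.
  have -> : r = Dseq R 2 - 1 by rewrite /r; congr (Dseq R _ - 1); lia.
  by rewrite Dseq2_sqr.
(* The mean required of the [j]-th powers of the translated points; [p j] is the corresponding sum
   over [n] points. *)
pose mu j := \sum_(i < j.+1) (- A 1%N) ^+ (j - i) * A i ^+ i *+ 'C(j, i).
pose p j := n%:R * mu j.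
have [c [c0 rec]] := newton_coefs p n.
have [s [szs pow_s root_s]] := roots_of_power_sums c0 rec.
pose S k := Normc.normc (c k) / (r * b) ^+ k.
have rb0 : 0 < r * b by exact: mulr_gt0.
have S_le1 : \sum_(1 <= k < n.+1) S k <= 1.
  apply: (@majorant_sum_le1 _ n r) => // [|k|k kn].
  - by rewrite /S c0 Normc.normc1 expr0 divr1.
  - by rewrite divr_ge0 ?normc_ge0 // exprn_ge0 // ltW.
  rewrite /S mulrA -[k%:R]normc_natr -Normc.normcM rec // normc_opp.
  rewrite ler_pdivrMr ?exprn_gt0 //; apply: le_trans (normc_sum _ _ _) _.
  rewrite mulr_sumr mulr_suml; apply: ler_sum => l _.
  have lk : (l < k)%N by [].
  rewrite /p 2!Normc.normcM normc_natr.
  have -> : n%:R * (Normc.normc (c l) / (r * b) ^+ l *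
      ((2 ^+ (k - l) - 2) / r ^+ (k - l))) * (r * b) ^+ k =
      Normc.normc (c l) * (n%:R * ((2 ^+ (k - l) - 2) * b ^+ (k - l))).
    have -> : (r * b) ^+ k = (r * b) ^+ l * (r * b) ^+ (k - l).
      by rewrite -exprD subnKC // ltnW.
    rewrite !exprMn; field.
    by rewrite !expf_neq0 //; lra.
  rewrite ler_wpM2l ?normc_ge0 // ler_wpM2l //.
  by apply: centred_moment_bound Ab _; lia.
(* The binomial expansion also needs exponent 0, where [mu 0 = 1] and [s] has [n] entries. *)
have pow_mu j : (j <= n)%N -> \sum_(v <- s) v ^+ j = n%:R * mu j.
  case: j => [_|j jn]; last by rewrite pow_s.
  rewrite /mu big_ord1 bin0 !expr0 mul1r mulr1 -szs.
  by rewrite big_const_seq count_predT iter_addr_0.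
have s_le v : v \in s -> Normc.normc v <= r * b.
  by move=> vs; apply: cauchy_root_bound c0 (root_s v vs) S_le1.
exists (fun k => A 1%N + nth 0 s (k %% n)); split.
  move=> j jn.
  have -> : \sum_(k < n`!) (A 1%N + nth 0 s (k %% n)) ^+ j =
      (\sum_(v <- s) (A 1%N + v) ^+ j) *+ n.-1`!.
    rewrite -(sum_copies 0 s (fun v => (A 1%N + v) ^+ j)) szs.
    by rewrite -factE.
  have -> : \sum_(v <- s) (A 1%N + v) ^+ j = n%:R * A j ^+ j.
    under eq_bigr => v _ do rewrite exprDn.
    rewrite exchange_big /= -(binomial_inversion (fun i => A i ^+ i) (A 1%N) j).
    rewrite mulr_sumr; apply: eq_bigr => i _; rewrite sumrMnl -mulr_sumr.
    rewrite pow_mu; last by have := leq_ord i; lia.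
    by rewrite mulrCA mulrnAr.
  rewrite -mulrnAl -[n%:R *+ _]mulr_natr -natrM mulnC -factE mulKf //.
apply: bigmax_le => [|k _]; first by rewrite mulr_ge0 ?Dseq_ge0.
apply: le_trans (normc_le_add _ _) _.
have -> : Dseq R n * b = b + r * b by rewrite /r; ring.
rewrite lerD ?Ab ?hn // s_le // mem_nth // szs ltn_mod; lia.
Qed.
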